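(* Let $M$ be the interior of an orientable, connected, compact 3-manifold with non-empty boundary consisting of tori, and let $\mathcal T$ be an ideal triangulation of $M$. The set $\mathfrak D_{\text{pre-}\infty}(\mathcal T)$ is homeomorphic with the projective admissible solution space $PF(\mathcal T)$ of spun-normal surface theory. In particular, $\mathfrak D_\infty(\mathcal T)$ is homeomorphic with a closed subset of $PF(\mathcal T)$.
   Context: **Ideal triangulation and deformation variety.** An ideal triangulation $\mathcal T$ of $M$ consists of finitely many Euclidean 3-simplices and face pairings such that $M$ is the quotient minus the vertices. The ideal tetrahedra $\sigma_1,\dots,\sigma_n$ are coherently oriented; there are also $n$ ideal edges $e_1,\dots,e_n$. Label the edges of a standard oriented 3-simplex by $z,z',z''$ so that opposite edges have equal labels and all three labels occur at each vertex; up to orientation-preserving symmetry there are two such labelings; fix one and transfer it to every $\sigma_i$ by an orientation-preserving simplicial map, giving labels $z_i,z_i',z_i''$. Let $a^{(k)}_{ij}$ be the number of edges of $\sigma_i$ with label $z_i^{(k)}$ that are identified to $e_j$. Define the polynomials $$p_i=z_i(1-z_i'')-1,\quad p_i'=z_i'(1-z_i)-1,\quad p_i''=z_i''(1-z_i')-1,\quad g_j=\prod_{i=1}^n z_i^{a_{ij}}(z_i')^{a'_{ij}}(z_i'')^{a''_{ij}}-1$$ for $i,j=1,\dots,n$. The deformation variety $\mathfrak D(\mathcal T)\subset(\mathbb C\setminus\{0\})^{3n}$ is the common zero set of all $p_i,p_i',p_i'',g_j$, in coordinates $Z=(z_1,z_1',z_1'',\dots,z_n,z_n',z_n'')$. **Logarithmic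 limit set.** Put $\log|Z|=(\log|z_1|,\dots,\log|z_n''|)$ and $u(Z)=(1+\sum(\log|z_i^{(k)}|)^2)^{-1/2}$. $\mathfrak D_\infty(\mathcal T)\subset S^{3n-1}$ is the set of limit points on the unit sphere $S^{3n-1}$ of the image of $\mathfrak D(\mathcal T)$ under $Z\mapsto u(Z)\log|Z|$. **Tropical pre-variety.** For a polynomial $f$ in $3n$ variables with set of exponent vectors $F\subset\mathbb Z^{3n}$, let $Sph(f)\subset S^{3n-1}$ (the spherical dual of its Newton polytope) be the set of unit vectors $\xi$ for which there are distinct $\alpha_0,\alpha_1\in F$ with $\alpha_0\cdot\xi\ge\alpha\cdot\xi$ and $\alpha_1\cdot\xi\ge\alpha\cdot\xi$ for all $\alpha\in F$. Set $$\mathfrak D_{\text{pre-}\infty}(\mathcal T)=\bigcap_{i=1}^n\big(Sph(g_i)\cap Sph(p_i)\cap Sph(p_i')\cap Sph(p_i'')\big);$$ one has $\mathfrak D_\infty(\mathcal T)\subseteq\mathfrak D_{\text{pre-}\infty}(\mathcal T)$. **Projective admissible solution space.** With real coordinates $(q_1,q_1',q_1'',\dots,q_n'')$ (one for each normal quadrilateral type in each tetrahedron, $q_i^{(k)}$ being the type disjoint from the edges labelled $z_i^{(k)}$), $PF(\mathcal T)\subset\mathbb R^{3n}$ is the set of vectors with all coordinates $\ge0$ and coordinate sum $1$, such that for each $i$ at most one of $q_i,q_i',q_i''$ is non-zero, and satisfying the $Q$-matching equations $$0=\sum_{i=1}^n (a''_{ij}-a'_{ij})q_i+(a_{ij}-a''_{ij})q_i'+(a'_{ij}-a_{ij})q_i''\qquad(j=1,\dots,n).$$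 *)

(* Defs.v *)
From HB Require Import structures.
From mathcomp Require Import all_boot all_order all_algebra all_fingroup.
From mathcomp Require Import generic_quotient.
From mathcomp Require Import all_classical all_reals all_analysis.
From mathcomp Require Import complex.
From mathcomp Require Import (canonicals) mpoly.
From Stdlib Require Import Relation_Operators.

Set Implicit Arguments.
Unset Strict Implicit.
Unset Printing Implicit Defensive.

Import Order.TTheory GRing.Theory Num.Theory.
Import numFieldNormedType.Exports.

Local Open Scope classical_set_scope.
Local Open Scope ring_scope.

(* Homeomorphism between a subset of T and a subset of U, both carrying the
   subspace topology. *)
Definition homeomorphic (T U : topologicalType) (A : set T) (B : set U) : Prop :=
  exists (f : T -> U) (g : U -> T),
    [/\ (forall x, A x -> B (f x)) /\ (forall y, B y -> A (g y)),
        forall x, A x -> g (f x) = x,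
        forall y, B y -> f (g y) = y,
        {within A, continuous f}
      & {within B, continuous g}].

Section Manifolds.
Variables (R : realType) (N : topologicalType).

Definition half_space3 : set 'rV[R]_3 := [set v | 0 <= v 0 0].

Definition has_half_space_chart (x : N) : Prop :=
  exists (U : set N) (W : set 'rV[R]_3),
    [/\ open U, U x, open W & homeomorphic U (half_space3 `&` W)].

Definition has_euclidean_chart (x : N) : Prop :=
  exists (U : set N) (W : set 'rV[R]_3),
    [/\ open U, U x, open W & homeomorphic U W].

Definition manifold3_with_boundary : Prop :=
  [/\ hausdorff_space N, @second_countable N
    & forall x : N, has_half_space_chart x].

Definition manifold_interior : set N := [set x | has_euclidean_chart x].

Definition manifold_boundary : set N := ~` manifold_interior.

Definition torus : set ((R * R) * (R * R)) :=
  [set p | p.1.1 ^+ 2 + p.1.2 ^+ 2 = 1 /\ p.2.1 ^+ 2 + p.2.2 ^+ 2 = 1].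

Definition boundary_consists_of_tori : Prop :=
  forall x, manifold_boundary x ->
    homeomorphic (connected_component manifold_boundary x) torus.

End Manifolds.

Arguments manifold_interior R N : clear implicits.
Arguments manifold_boundary R N : clear implicits.

(* n coherently oriented 3-simplices with their faces paired.  The vertices of
   each simplex are numbered by 'I_4 so that the numbering is an
   orientation-preserving identification with the standard oriented simplex.
   Face f is the face opposite to vertex f.  Face f of simplex i is glued to a
   face of simplex [glue_simplex i f]; the vertex v <> f of the first goes to the
   vertex [glue_perm i f v] of the second, and the value at f is the vertex
   opposite to the target face.  The orientations of the two simplices agree
   across the face iff this permutation is odd, so a gluing whose permutations
   are all odd is one whose simplices are coherently oriented; its existence on
   a triangulation of a connected M is the orientability of M. *)
Record oriented_gluing (n : nat) := OrientedGluing {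
  glue_simplex : 'I_n -> 'I_4 -> 'I_n;
  glue_perm : 'I_n -> 'I_4 -> 'S_4;
  glue_simplexK : forall i f,
    glue_simplex (glue_simplex i f) (glue_perm i f f) = i;
  glue_permK : forall i f,
    glue_perm (glue_simplex i f) (glue_perm i f f) = ((glue_perm i f)^-1)%g;
  glue_neq : forall i f, (glue_simplex i f, glue_perm i f f) <> (i, f);
  glue_coherent : forall i f, odd_perm (glue_perm i f)
}.

Section Realization.
Variables (R : realType) (n : nat) (T : oriented_gluing n).

Definition simplex3 : set 'rV[R]_4 :=
  [set v | (forall k, 0 <= v 0 k) /\ \sum_k v 0 k = 1].

Definition simplices : topologicalType := {i : 'I_n & set_type simplex3}.

Definition face_pairing (x y : simplices) : Prop :=
  exists f : 'I_4,
    [/\ val (projT2 x) 0 f = 0,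
        projT1 y = glue_simplex T (projT1 x) f
      & forall k, val (projT2 y) 0 (glue_perm T (projT1 x) f k)
                  = val (projT2 x) 0 k].

Definition glued : rel simplices :=
  fun x y => `[< clos_refl_sym_trans simplices face_pairing x y >].

Lemma glued_refl : reflexive glued.
Proof. by move=> x; apply/asboolP; exact: rst_refl. Qed.

Lemma glued_sym : symmetric glued.
Proof. by move=> x y; apply/asboolP/asboolP; exact: rst_sym. Qed.

Lemma glued_trans : transitive glued.
Proof.
by move=> y x z /asboolP xy /asboolP yz; apply/asboolP; exact: rst_trans xy yz.
Qed.

Canonical glued_equiv := EquivRel glued glued_refl glued_sym glued_trans.

Definition pseudo_manifold : topologicalType :=
  quotient_topology {eq_quot glued_equiv}%qT.

Definition ideal_vertices : set pseudo_manifold :=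
  [set (\pi_({eq_quot glued_equiv}) x)%qT | x in
     [set x : simplices | exists k, val (projT2 x) 0 k = 1]].

End Realization.

Arguments ideal_vertices R {n} T.

Definition ideal_triangulation_of (R : realType) (X : topologicalType)
    (M : set X) (n : nat) (T : oriented_gluing n) : Prop :=
  homeomorphic M (~` ideal_vertices R T).

Section Edges.
Variables (n : nat) (T : oriented_gluing n).

(* An edge of a simplex is the set of its two endpoints. *)
Definition is_edge (s : {set 'I_4}) : bool := #|s| == 2%N.

Definition simplex_edges : {set 'I_n * {set 'I_4}} :=
  [set x : 'I_n * {set 'I_4} | is_edge x.2]%SET.

Definition edge_pairing : rel ('I_n * {set 'I_4}) := fun x y =>
  [exists f : 'I_4, [&& f \notin x.2, y.1 == glue_simplex T x.1 f
                      & y.2 == [set glue_perm T x.1 f v | v in x.2]%SET]].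

(* An ideal edge is the class of the simplex edges identified to it. *)
Definition ideal_edges : {set {set 'I_n * {set 'I_4}}} :=
  equivalence_partition (connect edge_pairing) simplex_edges.

Definition edge_enumeration (e : 'I_n -> {set 'I_n * {set 'I_4}}) : Prop :=
  injective e /\ [set e j | j in 'I_n]%SET = ideal_edges.

End Edges.

(* The labels z, z', z'' are 0, 1, 2 in 'I_3; [~: s] is the edge opposite to s. *)
Definition edge_labelling (lab : {set 'I_4} -> 'I_3) : Prop :=
  (forall s, is_edge s -> lab (~: s)%SET = lab s) /\
  (forall (v : 'I_4) (k : 'I_3),
     exists s : {set 'I_4}, [/\ is_edge s, v \in s & lab s = k]).

Section DeformationVariety.
Variables (R : realType) (n : nat).

(* Coordinate number of z_i^(k) in (z_1, z_1', z_1'', ..., z_n''). *)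
Definition zcoord (i : 'I_n) (k : 'I_3) : 'I_(n * 3) := mxvec_index i k.

(* [tau i] maps the standard labelled simplex onto the i-th simplex. *)
Variables (lab : {set 'I_4} -> 'I_3) (tau : 'I_n -> 'S_4)
  (e : 'I_n -> {set 'I_n * {set 'I_4}}).

Definition label (i : 'I_n) (s : {set 'I_4}) : 'I_3 := lab (tau i @^-1: s)%SET.

(* [incidence k i j] is the number a^(k)_ij. *)
Definition incidence (k : 'I_3) (i j : 'I_n) : nat :=
  #|[set s : {set 'I_4} | [&& is_edge s, label i s == k & (i, s) \in e j]]%SET|.

Notation poly3n := (mpoly.mpoly (n * 3) R[i]).

Definition zvar (i : 'I_n) (k : 'I_3) : poly3n :=
  mpoly.mpolyX R[i] (mpoly.mnm1 (zcoord i k)).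

Definition poly_p (i : 'I_n) : poly3n := zvar i 0 * (1 - zvar i 2%:R) - 1.
Definition poly_p' (i : 'I_n) : poly3n := zvar i 1 * (1 - zvar i 0) - 1.
Definition poly_p'' (i : 'I_n) : poly3n := zvar i 2%:R * (1 - zvar i 1) - 1.

Definition poly_g (j : 'I_n) : poly3n :=
  \prod_(i < n) (zvar i 0 ^+ incidence 0 i j * zvar i 1 ^+ incidence 1 i j
                 * zvar i 2%:R ^+ incidence 2%:R i j) - 1.

Definition vanishes (f : poly3n) (Z : 'rV[R[i]]_(n * 3)) : Prop :=
  mpoly.meval (fun m => Z 0 m) f = 0.

Definition deformation_variety : set 'rV[R[i]]_(n * 3) :=
  [set Z : 'rV[R[i]]_(n * 3) | (forall m, Z 0 m != 0) /\
     forall i, [/\ vanishes (poly_p i) Z, vanishes (poly_p' i) Z,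
                   vanishes (poly_p'' i) Z & vanishes (poly_g i) Z]].

Definition log_abs (Z : 'rV[R[i]]_(n * 3)) : 'rV[R]_(n * 3) :=
  \row_m ln (Normc.normc (Z 0 m)).

Definition u_factor (Z : 'rV[R[i]]_(n * 3)) : R :=
  (Num.sqrt (1 + \sum_m (log_abs Z 0 m) ^+ 2))^-1.

Definition unit_sphere : set 'rV[R]_(n * 3) :=
  [set xi : 'rV[R]_(n * 3) | \sum_m (xi 0 m) ^+ 2 = 1].

Definition D_infty : set 'rV[R]_(n * 3) :=
  unit_sphere `&`
  limit_point [set u_factor Z *: log_abs Z | Z in deformation_variety].

Definition exp_dot (alpha : mpoly.multinom (n * 3)) (xi : 'rV[R]_(n * 3)) : R :=
  \sum_m (mpoly.fun_of_multinom alpha m)%:R * xi 0 m.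

Definition Sph (f : poly3n) : set 'rV[R]_(n * 3) :=
  [set xi : 'rV[R]_(n * 3) | unit_sphere xi /\
     exists alpha0 alpha1,
       [/\ alpha0 \in mpoly.msupp f, alpha1 \in mpoly.msupp f, alpha0 <> alpha1
         & forall alpha, alpha \in mpoly.msupp f ->
             exp_dot alpha xi <= exp_dot alpha0 xi /\
             exp_dot alpha xi <= exp_dot alpha1 xi]].

(* Intersecting with the sphere only matters when n = 0. *)
Definition D_pre_infty : set 'rV[R]_(n * 3) :=
  unit_sphere `&`
  \bigcap_(i in [set: 'I_n])
    (Sph (poly_g i) `&` Sph (poly_p i) `&` Sph (poly_p' i) `&` Sph (poly_p'' i)).

Definition Q_matching (j : 'I_n) (q : 'rV[R]_(n * 3)) : Prop :=
  0 = \sum_(i < n)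
        (((incidence 2%:R i j)%:R - (incidence 1 i j)%:R) * q 0 (zcoord i 0)
         + ((incidence 0 i j)%:R - (incidence 2%:R i j)%:R) * q 0 (zcoord i 1)
         + ((incidence 1 i j)%:R - (incidence 0 i j)%:R) * q 0 (zcoord i 2%:R)).

Definition PF : set 'rV[R]_(n * 3) :=
  [set q : 'rV[R]_(n * 3) | [/\ forall m, 0 <= q 0 m,
               \sum_m q 0 m = 1,
               forall i (k l : 'I_3),
                 q 0 (zcoord i k) != 0 -> q 0 (zcoord i l) != 0 -> k = l
             & forall j, Q_matching j q]].

End DeformationVariety.

Arguments D_infty R {n} lab tau e.
Arguments D_pre_infty R {n} lab tau e.
Arguments PF R {n} lab tau e.

(* Main.v *)
Require Import Defs.
From mathcomp Require Import all_boot all_order all_algebra all_fingroup.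
From mathcomp Require Import all_classical all_reals all_analysis.
From mathcomp Require Import complex lra ring.
From mathcomp Require Import (canonicals) mpoly.
Set Implicit Arguments.
Unset Strict Implicit.
Unset Printing Implicit Defensive.
Import Order.TTheory GRing.Theory Num.Theory.
Import numFieldNormedType.Exports.
Local Open Scope classical_set_scope.
Local Open Scope ring_scope.

(** Both spaces are unit sections of closed cones, and the proof exhibits two
    mutually inverse, positively homogeneous, continuous maps between the cones.

    Each p_i^(k) is a trinomial with monomials z, z z_ and 1, where z = z_i^(k)
    and z_ is the variable preceding it cyclically, so xi lies in its spherical
    dual iff the three numbers a, a + c, 0 (a and c the coordinates of xi at z
    and z_) attain their maximum at least twice, a condition called [balanced]
    below.  Each g_j is a monomial minus 1, and the monomial is not constant
    because every ideal edge contains some edge of a tetrahedron; its dual is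
    therefore cut out of the sphere by a linear hyperplane.

    On one tetrahedron the three balance conditions leave exactly three rays,
    through (0,1,-1), (-1,0,1) and (1,-1,0): they correspond to the three
    quadrilateral types.  Writing q for the multiple along each ray, the
    coordinates of xi are differences of the q (the map [shape]), and q is
    recovered as the positive part of xi, cyclically shifted (the map [quads]).
    Under this correspondence the hyperplane of g_j is the j-th Q-matching
    equation up to sign ([edge_shape]).  Rescaling the two maps turns the
    sphere into the simplex and back ([homeomorphic_of_cones]).

    For the second claim it suffices that D_infty is closed and contained in
    D_pre_infty.  On the image w of a point Z of the deformation variety the
    triangle inequality in z - z z_ - 1 = 0 gives the balance conditions up to
    the error u(Z) ln 2, and u(Z) = sqrt (1 - |w|^2).  The approximate condition
    is thus a closed condition in w alone, which becomes exact on the sphere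
    ([deformation_variety_almost_tropical], [D_infty_sub_pre]). *)

(** * Homeomorphisms and continuity *)

(** The witness is the closure of the image of C.  The image itself need not be
    closed in U, but no point of B is added: if y in B is a limit of f @` C then
    g y is a limit of points of C. *)
Lemma homeomorphic_closed_subset (T U : topologicalType) (A C : set T)
    (B : set U) :
  homeomorphic A B -> closed C -> C `<=` A ->
  exists K, closed K /\ homeomorphic C (B `&` K).
Proof.
move=> [f [g [[fAB gBA] fK gK cf cg]]] Ccl CA.
exists (closure (f @` C)); split; first exact: closed_closure.
exists f, g; split.
- split=> [x Cx|y [By fCy]].
    by split; [exact/fAB/CA|apply: subset_closure; exists x].
  apply: Ccl => V /= Vgy.
  move/subspace_continuousP : cg => /(_ _ By _ Vgy) gV.
  have [_ [[x Cx <-] /(_ (fAB _ (CA _ Cx)))]] := fCy _ gV.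
  by move=> gfx; exists x; split=> //; rewrite -(fK x (CA x Cx)).
- by move=> x /CA /fK.
- by move=> y [/gK].
- exact: continuous_subspaceW CA cf.
- by apply: continuous_subspaceW cg => y [].
Qed.

Lemma closure_ge0 (R : realType) (T : topologicalType) (S : set T)
    (F : T -> R) :
  continuous F -> (forall x, S x -> 0 <= F x) ->
  forall x, closure S x -> 0 <= F x.
Proof.
move=> cF F0 x Sx.
have cl : closed (F @^-1` [set y | 0 <= y]).
  by apply: preimage_closed => [? _|]; [exact: cF|exact: closed_ge].
by apply: cl; apply: closure_subset Sx => y /F0.
Qed.

Section RowContinuity.
Variables (R : realType) (T : topologicalType).

Lemma continuous_row p (f : T -> 'rV[R]_p) :
  (forall m, continuous (fun y => f y 0 m)) -> continuous f.
Proof.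
move=> cf x A [P nP sPA].
have : \forall y \near x, forall m, P 0 m (f y 0 m).
  by apply: filter_forall => m; exact: cf (nP 0 m).
by apply: filterS => y Py; apply: sPA => i m; rewrite ord1.
Qed.

Lemma continuous_sum (I : Type) (r : seq I) (F : I -> T -> R) (x : T) :
  (forall i, {for x, continuous (F i)}) ->
  {for x, continuous (fun y => \sum_(i <- r) F i y)}.
Proof.
by move=> cF; apply: cvg_big => [|i _]; [exact: add_continuous|exact: cF].
Qed.

End RowContinuity.

(** * Unit sections of homogeneous cones *)

Section Cones.
Variables (R : realType) (p : nat).
Implicit Types (C : set 'rV[R]_p) (N : 'rV[R]_p -> R).

Definition cone C := forall c x, 0 < c -> C x -> C (c *: x).
Definition homogeneous (V : lmodType R) (f : 'rV[R]_p -> V) :=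
  forall c x, 0 < c -> f (c *: x) = c *: f x.

(** The homeomorphism is phi followed by division by N2, and its inverse is psi
    followed by division by N1; homogeneity makes the two scalars cancel. *)
Lemma homeomorphic_of_cones C D N1 N2 (phi psi : 'rV[R]_p -> 'rV[R]_p) :
  cone C -> cone D ->
  continuous N1 -> continuous N2 -> @homogeneous R^o N1 -> @homogeneous R^o N2 ->
  continuous phi -> continuous psi -> homogeneous phi -> homogeneous psi ->
  (forall x, C x -> D (phi x)) -> (forall y, D y -> C (psi y)) ->
  (forall x, C x -> psi (phi x) = x) -> (forall y, D y -> phi (psi y) = y) ->
  (forall x, C x -> N1 x = 1 -> 0 < N2 (phi x)) ->
  (forall y, D y -> N2 y = 1 -> 0 < N1 (psi y)) ->
  homeomorphic (C `&` [set x | N1 x = 1]) (D `&` [set y | N2 y = 1]).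
Proof.
(* By symmetry it is enough to treat one of the two rescaled maps. *)
have half (C' D' : set 'rV[R]_p) M1 M2 (f g : 'rV[R]_p -> 'rV[R]_p) :
    cone D' -> continuous M2 -> @homogeneous R^o M1 -> @homogeneous R^o M2 ->
    continuous f -> homogeneous g ->
    (forall x, C' x -> D' (f x)) -> (forall x, C' x -> g (f x) = x) ->
    (forall x, C' x -> M1 x = 1 -> 0 < M2 (f x)) ->
    let F x := (M2 (f x))^-1 *: f x in
    let G y := (M1 (g y))^-1 *: g y in
    let A := C' `&` [set x | M1 x = 1] in
    [/\ forall x, A x -> (D' `&` [set y | M2 y = 1]) (F x),
        forall x, A x -> G (F x) = x
      & {within A, continuous F}].
  move=> cD cM2 hM1 hM2 cf hg fD fK pos F G A; split.
  - move=> x [Cx M1x]; have M0 := pos _ Cx M1x; split.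
      by apply: cD; [rewrite invr_gt0|exact: fD].
    by rewrite /= /F hM2 ?invr_gt0// [LHS]mulVf// gt_eqF.
  - move=> x [Cx M1x]; have M0 := pos _ Cx M1x.
    rewrite /G /F hg ?invr_gt0// fK// hM1 ?invr_gt0// M1x.
    by rewrite [_ *: 1]mulr1 invrK scalerA mulfV ?scale1r// gt_eqF.
  - apply: continuous_in_subspaceT => x; rewrite inE => -[Cx M1x].
    have M0 := pos _ Cx M1x.
    have cM2f : {for x, continuous (fun y => M2 (f y))}.
      by apply: continuous_comp; [exact: cf|exact: cM2].
    have cV : {for x, continuous (fun y => (M2 (f y))^-1)}.
      by apply: continuousV => //; rewrite gt_eqF.
    exact: cvgZ cV (cf x).
move=> cC cD cN1 cN2 hN1 hN2 cphi cpsi hphi hpsi CD DC phiK psiK posC posD.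
have [FD FK cF] := half C D N1 N2 phi psi cD cN2 hN1 hN2 cphi hpsi CD phiK posC.
have [GC GK cG] := half D C N2 N1 psi phi cC cN1 hN2 hN1 cpsi hphi DC psiK posD.
by exists (fun x => (N2 (phi x))^-1 *: phi x),
          (fun y => (N1 (psi y))^-1 *: psi y); split.
Qed.

End Cones.

(** * Triples whose maximum is attained twice *)

Section Balanced.
Variable R : realType.

(** For d = 0 this says that the maximum of x, y, z is attained at least twice.
    Bounding each number by the maximum of the others, instead of comparing
    cases, gives a closed condition that also makes sense up to an error d. *)
Definition balanced_upto (d x y z : R) :=
  [/\ x <= Num.max y z + d, y <= Num.max x z + d & z <= Num.max x y + d].

Definition balanced := balanced_upto 0.

Lemma balanced_scale_upto c d x y z :
  0 <= c -> balanced_upto d x y z ->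
  balanced_upto (c * d) (c * x) (c * y) (c * z).
Proof.
by move=> c0 [xyz yxz zxy]; split; rewrite -!maxr_pMr// -mulrDr ler_wpM2l.
Qed.

Lemma balanced_scale c x y z :
  0 < c -> balanced x y z -> balanced (c * x) (c * y) (c * z).
Proof. by move=> c0 /(balanced_scale_upto (ltW c0)); rewrite mulr0. Qed.

(** Because y + z <= 2 max (y, z). *)
Lemma ln_le_max (x y z : R) : 0 < x -> 0 < y -> 0 < z -> x <= y + z ->
  ln x <= Num.max (ln y) (ln z) + ln 2.
Proof.
wlog yz : y z / y <= z => [hw|] x0 y0 z0 xyz.
  have [yz|/ltW zy] := leP y z; first exact: hw.
  by rewrite maxC; apply: hw => //; rewrite addrC.
have -> : Num.max (ln y) (ln z) = ln z by apply/max_idPr; rewrite ler_ln.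
rewrite -lnM ?posrE// ler_ln ?posrE ?mulr_gt0//.
by apply: (le_trans xyz); rewrite mulrDr mulr1 lerD.
Qed.

(** The triple a, a + c, 0 is balanced exactly when (a, c) is on one of three
    rays, through (0, -1), (-1, 1) and (1, 0); both conclusions are read off
    there. *)
Lemma balanced_posP (a c : R) : balanced a (a + c) 0 ->
  a = Num.max a 0 - Num.max c 0 /\ (Num.max a 0 = 0 \/ Num.max c 0 = 0).
Proof.
rewrite /balanced /balanced_upto !addr0 /Num.max => -[].
do 5?case: ltP => ?; move=> *; split; (lra || (left; lra) || (right; lra)).
Qed.

Lemma balanced_diff (x y z : R) : 0 <= x -> 0 <= y -> 0 <= z ->
  (x = 0 \/ y = 0) -> (x = 0 \/ z = 0) -> (y = 0 \/ z = 0) ->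
  balanced (x - y) (x - z) 0.
Proof.
rewrite /balanced /balanced_upto !addr0 /Num.max => x0 y0 z0 xy xz yz.
by do 4?case: ltP => ?; case: xy xz yz => ? [] ? [] ?; split; lra.
Qed.

End Balanced.

(** * Monomials, their logarithms and spherical duals *)

Section Monomials.
Variables (R : realType) (n : nat).
Notation mon := (mpoly.multinom (n * 3)).
Notation mX m := (mpoly.mpolyX R[i] m).
Implicit Types (x : 'rV[R]_(n * 3)) (m : mon) (Z : 'rV[R[i]]_(n * 3)).

Lemma exp_dot0 x : exp_dot mpoly.mnm0 x = 0.
Proof. by rewrite /exp_dot big1// => k _; rewrite mpoly.mnm0E mul0r. Qed.

Lemma exp_dotD m1 m2 x :
  exp_dot (mpoly.mnm_add m1 m2) x = exp_dot m1 x + exp_dot m2 x.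
Proof.
rewrite /exp_dot -big_split/=; apply: eq_bigr => k _.
by rewrite mpoly.mnmDE natrD mulrDl.
Qed.

Lemma exp_dot_var k a x :
  exp_dot (mpoly.mnm_muln (mpoly.mnm1 k) a) x = a%:R * x 0 k.
Proof.
rewrite /exp_dot (bigD1 k)//= big1 => [|l lk].
  by rewrite mpoly.mulmnE mpoly.mnm1E eqxx mul1n addr0.
by rewrite mpoly.mulmnE mpoly.mnm1E eq_sym (negPf lk) mul0r.
Qed.

Lemma exp_dot_sum (I : Type) (r : seq I) (F : I -> mon) x :
  exp_dot (\big[mpoly.mnm_add/mpoly.mnm0]_(i <- r) F i) x
  = \sum_(i <- r) exp_dot (F i) x.
Proof.
by elim/big_rec2: _ => [|i y m _ <-]; [exact: exp_dot0|exact: exp_dotD].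
Qed.

Lemma exp_dotZ m c x : exp_dot m (c *: x) = c * exp_dot m x.
Proof.
by rewrite /exp_dot mulr_sumr; apply: eq_bigr => k _; rewrite mxE mulrCA.
Qed.

Lemma continuous_exp_dot m : continuous (@exp_dot R n m).
Proof.
move=> x; apply: continuous_sum => k.
apply: continuousM; first exact: cst_continuous.
exact: coord_continuous.
Qed.

Definition mon_at Z m : R[i] := mpoly.meval (fun k => Z 0 k) (mX m).

Lemma normc_mon_at Z m : (forall k, Z 0 k != 0) ->
  Normc.normc (mon_at Z m) = expR (exp_dot m (log_abs Z)).
Proof.
move=> Z0; rewrite /mon_at mpoly.mevalX expR_sum.
rewrite (big_morph (@Normc.normc R) (@Normc.normcM R) (Normc.normc1 R)).
apply: eq_bigr => k _; rewrite mxE expRM_natl lnK.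
  by elim: (mpoly.fun_of_multinom m k) => [|a IH]; rewrite ?expr0 ?Normc.normc1//
    !exprS Normc.normcM IH.
rewrite posrE lt_neqAle eq_sym; apply/andP; split.
  by apply/eqP => /Normc.eq0_normc; exact/eqP.
by case: (Z 0 k) => a b; exact: sqrtr_ge0.
Qed.

(** If three complex numbers sum to zero up to signs, each absolute value is at
    most the sum of the two others; [ln_le_max] takes this to logarithms. *)
Lemma mon_trinomial_balanced Z m1 m2 m3 : (forall k, Z 0 k != 0) ->
  vanishes (mX m1 - mX m2 - mX m3) Z ->
  balanced_upto (ln 2) (exp_dot m1 (log_abs Z)) (exp_dot m2 (log_abs Z))
    (exp_dot m3 (log_abs Z)).
Proof.
move=> Z0; rewrite /vanishes !mpoly.mevalB -/(mon_at Z m1) -/(mon_at Z m2)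
  -/(mon_at Z m3) => E.
have tri (a b c : R[i]) : a = b + c \/ a = b - c ->
    Normc.normc a <= Normc.normc b + Normc.normc c.
  case=> ->; first exact: le_normcD.
  by rewrite -(normcN c); exact: le_normcD.
have ln_tri k1 k2 k3 : mon_at Z k1 = mon_at Z k2 + mon_at Z k3 \/
    mon_at Z k1 = mon_at Z k2 - mon_at Z k3 ->
    exp_dot k1 (log_abs Z) <=
      Num.max (exp_dot k2 (log_abs Z)) (exp_dot k3 (log_abs Z)) + ln 2.
  move=> /tri; rewrite !normc_mon_at// => H.
  have := ln_le_max (expR_gt0 _) (expR_gt0 _) (expR_gt0 _) H.
  by rewrite !expRK.
split; apply: ln_tri.
- by left; apply/eqP; rewrite -subr_eq0 opprD addrA E.
- by right; apply/eqP; rewrite -subr_eq0 -oppr_eq0 -E; apply/eqP; ring.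
- by right; apply/eqP; rewrite -subr_eq0 -oppr_eq0 -E; apply/eqP; ring.
Qed.

Lemma mon_binomial_dot Z m : (forall k, Z 0 k != 0) ->
  vanishes (mX m - 1) Z -> exp_dot m (log_abs Z) = 0.
Proof.
move=> Z0; rewrite /vanishes mpoly.mevalB mpoly.meval1 => /eqP.
rewrite subr_eq0 -/(mon_at Z m) => /eqP E.
by apply: expR_inj; rewrite -normc_mon_at// E Normc.normc1 expR0.
Qed.

Lemma Sph_trinomial m1 m2 m3 x : m1 != m2 -> m1 != m3 -> m2 != m3 ->
  Sph (mX m1 - mX m2 - mX m3) x <->
  unit_sphere x /\ balanced (exp_dot m1 x) (exp_dot m2 x) (exp_dot m3 x).
Proof.
move=> m12 m13 m23.
have supp a : a \in mpoly.msupp (mX m1 - mX m2 - mX m3) =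
    [|| a == m1, a == m2 | a == m3].
  rewrite mpoly.mcoeff_msupp !mpoly.mcoeffB !mpoly.mcoeffX.
  have [->|_] := eqVneq a m1.
    by rewrite !(eq_sym _ m1) (negPf m12) (negPf m13) !mulr0n !subr0 oner_eq0.
  have [->|_] := eqVneq a m2.
    by rewrite (eq_sym m3) (negPf m23) !mulr0n sub0r subr0 oppr_eq0 oner_eq0.
  by have [_|_] := eqVneq a m3;
    rewrite !mulr0n !subr0 ?sub0r ?oppr_eq0 ?oner_eq0 ?eqxx.
have s1 : m1 \in mpoly.msupp (mX m1 - mX m2 - mX m3) by rewrite supp eqxx.
have s2 : m2 \in mpoly.msupp (mX m1 - mX m2 - mX m3) by rewrite supp eqxx orbT.
have s3 : m3 \in mpoly.msupp (mX m1 - mX m2 - mX m3) by rewrite supp eqxx !orbT.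
rewrite /Sph /balanced /balanced_upto !addr0 /=; split.
  move=> [ux [a0 [a1 [a0s a1s a01 amax]]]]; split=> //.
  have [p1 q1] := amax _ s1; have [p2 q2] := amax _ s2.
  have [p3 q3] := amax _ s3.
  move: a0s a1s p1 p2 p3 q1 q2 q3 a01; rewrite !supp => {amax}.
  case/or3P => /eqP ->; case/or3P => /eqP -> // *; rewrite !le_max;
    split; apply/orP; solve [by left | by right].
move=> [ux [b1 b2 b3]]; split=> //.
have maxi a0 a1 : a0 \in mpoly.msupp (mX m1 - mX m2 - mX m3) ->
    a1 \in mpoly.msupp (mX m1 - mX m2 - mX m3) -> a0 != a1 ->
    exp_dot a0 x = exp_dot a1 x ->
    exp_dot m1 x <= exp_dot a0 x -> exp_dot m2 x <= exp_dot a0 x ->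
    exp_dot m3 x <= exp_dot a0 x ->
  exists alpha0 alpha1 : mon,
    [/\ alpha0 \in mpoly.msupp (mX m1 - mX m2 - mX m3),
        alpha1 \in mpoly.msupp (mX m1 - mX m2 - mX m3), alpha0 <> alpha1
      & forall alpha, alpha \in mpoly.msupp (mX m1 - mX m2 - mX m3) ->
             exp_dot alpha x <= exp_dot alpha0 x /\
             exp_dot alpha x <= exp_dot alpha1 x].
  move=> sa0 sa1 /eqP a01 E l1 l2 l3; exists a0, a1; split=> // a.
  by rewrite supp -E => /or3P[] /eqP ->.
move: b1 b2 b3; rewrite /Num.max.
case: ltP => l23; case: ltP => l13; case: ltP => l12 b1 b2 b3.
all: first [apply: (maxi m1 m2) => //; lra | apply: (maxi m1 m3) => //; lra
  | apply: (maxi m2 m3) => //; lra].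
Qed.

Lemma Sph_binomial m x : m != mpoly.mnm0 ->
  Sph (mX m - 1) x <-> unit_sphere x /\ exp_dot m x = 0.
Proof.
move=> m0.
have supp a : a \in mpoly.msupp (mX m - 1) = (a == m) || (a == mpoly.mnm0).
  rewrite mpoly.mcoeff_msupp mpoly.mcoeffB mpoly.mcoeffX mpoly.mcoeff1.
  have [->|_] := eqVneq a m; first by rewrite (negPf m0) mulr0n subr0 oner_eq0.
  by have [_|_] := eqVneq a mpoly.mnm0;
    rewrite mulr0n ?subr0 ?sub0r ?oppr_eq0 ?oner_eq0 ?eqxx.
have s1 : m \in mpoly.msupp (mX m - 1) by rewrite supp eqxx.
have s0 : mpoly.mnm0 \in mpoly.msupp (mX m - 1) by rewrite supp eqxx orbT.
split.
  move=> [ux [a0 [a1 [a0s a1s a01 amax]]]]; split=> //.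
  have [] := amax _ s1; have [] := amax _ s0.
  move: a0s a1s a01; rewrite !supp => {amax}.
  by case/orP => /eqP ->; case/orP => /eqP -> //; rewrite exp_dot0 => *;
    apply/eqP; rewrite eq_le; apply/andP.
move=> [ux E]; split=> //; exists m, mpoly.mnm0; split=> //; first exact/eqP.
by move=> a; rewrite supp => /orP[] /eqP ->; rewrite exp_dot0 E.
Qed.

End Monomials.

(** * The tropical pre-variety as a section of a cone *)

(** The polynomials p_i, p_i', p_i'' involve the pairs of labels (0, 2), (1, 0)
    and (2, 1), that is, each label with its cyclic predecessor. *)
Lemma ord3_pred_cases (P : 'I_3 -> 'I_3 -> Prop) :
  P 0 2%:R -> P 1 0 -> P 2%:R 1 -> forall k, P k (k - 1).
Proof.
move=> P0 P1 P2 [[|[|[]]]// k3].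
- by congr (P _ _): P0; exact: val_inj.
- by congr (P _ _): P1; exact: val_inj.
- by congr (P _ _): P2; exact: val_inj.
Qed.

Section TropicalCone.
Variables (R : realType) (n : nat) (T : oriented_gluing n).
Variables (lab : {set 'I_4} -> 'I_3) (tau : 'I_n -> {perm 'I_4}).
Variable e : 'I_n -> {set 'I_n * {set 'I_4}}.
Hypothesis e_enum : edge_enumeration T e.
Notation mX m := (mpoly.mpolyX R[i] m).
Implicit Types (x q : 'rV[R]_(n * 3)).

Definition zexp (i : 'I_n) (k : 'I_3) : mpoly.multinom (n * 3) :=
  mpoly.mnm1 (zcoord i k).

Lemma exp_dot_zexp i k x : exp_dot (zexp i k) x = x 0 (zcoord i k).
Proof.
by have := exp_dot_var (zcoord i k) 1 x; rewrite mul1r.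
Qed.

Lemma shape_trinomialE i k l : zvar R i k * (1 - zvar R i l) - 1
  = mX (zexp i k) - mX (mpoly.mnm_add (zexp i k) (zexp i l)) - mX mpoly.mnm0.
Proof. by rewrite mpoly.mpolyXD mpoly.mpolyX0 mulrBr mulr1. Qed.

Lemma Sph_shape i k l x : k != l ->
  Sph (zvar R i k * (1 - zvar R i l) - 1) x <->
  unit_sphere x /\
    balanced (x 0 (zcoord i k)) (x 0 (zcoord i k) + x 0 (zcoord i l)) 0.
Proof.
move=> kl; rewrite shape_trinomialE Sph_trinomial ?exp_dotD ?exp_dot_zexp
  ?exp_dot0//; apply/eqP => /mpoly.mnmP E.
- have := E (zcoord i l).
  by rewrite mpoly.mnmDE [X in (_ + X)%N]mpoly.mnm1E eqxx addn1 => /n_Sn.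
- have := E (zcoord i k).
  by rewrite mpoly.mnm0E mpoly.mnm1E eqxx.
- have := E (zcoord i k).
  by rewrite mpoly.mnm0E mpoly.mnmDE mpoly.mnm1E eqxx.
Qed.

Definition edge_exponent (j : 'I_n) : mpoly.multinom (n * 3) :=
  \big[mpoly.mnm_add/mpoly.mnm0]_(i < n)
    mpoly.mnm_add
      (mpoly.mnm_add (mpoly.mnm_muln (zexp i 0) (incidence lab tau e 0 i j))
         (mpoly.mnm_muln (zexp i 1) (incidence lab tau e 1 i j)))
      (mpoly.mnm_muln (zexp i 2%:R) (incidence lab tau e 2%:R i j)).

Lemma poly_gE j : poly_g R lab tau e j = mX (edge_exponent j) - 1.
Proof.
rewrite /poly_g /edge_exponent; congr (_ - 1).
rewrite (big_morph (fun m => mX m) (@mpoly.mpolyXD _ _) (@mpoly.mpolyX0 _ _)).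
by apply: eq_bigr => i _; rewrite !mpoly.mpolyXD -!mpoly.mpolyXn.
Qed.

Lemma exp_dot_edge j x : exp_dot (edge_exponent j) x =
  \sum_(i < n) ((incidence lab tau e 0 i j)%:R * x 0 (zcoord i 0)
    + (incidence lab tau e 1 i j)%:R * x 0 (zcoord i 1)
    + (incidence lab tau e 2%:R i j)%:R * x 0 (zcoord i 2%:R)).
Proof.
rewrite exp_dot_sum; apply: eq_bigr => i _.
by rewrite !exp_dotD !exp_dot_var.
Qed.

(** An ideal edge is an equivalence class, so it contains a representative. *)
Lemma ideal_edge_occurs j :
  exists i s, is_edge s && ((i, s) \in e j).
Proof.
have : e j \in ideal_edges T by rewrite -e_enum.2 imset_f.
case/imsetP => -[i s]; rewrite inE /= => sedge ->; exists i, s.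
by rewrite sedge !inE sedge/= connect0.
Qed.

(** Without this, poly_g j would be the zero polynomial, with empty support and
    empty spherical dual. *)
Lemma edge_exponent_neq0 j : edge_exponent j != mpoly.mnm0.
Proof.
have [i [s /andP[sedge sj]]] := ideal_edge_occurs j.
(* Pairing with the all-ones vector gives the number of simplex edges in e j. *)
apply/eqP => /(congr1 (fun m => exp_dot m (const_mx 1 : 'rV[R]_(n * 3)))).
rewrite exp_dot0 exp_dot_edge; apply/eqP; rewrite gt_eqF//.
have term k' i' : 0 <= (incidence lab tau e k' i' j)%:R
    * (const_mx 1 : 'rV[R]_(n * 3)) 0 (zcoord i' k') by rewrite mxE mulr1 ler0n.
rewrite (bigD1 i)//= ltr_pwDl ?sumr_ge0// => [|i' _]; last by rewrite !addr_ge0.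
have pos : 0 < (incidence lab tau e (label lab tau i s) i j)%:R :> R.
  by rewrite ltr0n; apply/card_gt0P; exists s; rewrite inE sedge eqxx.
have := term 0 i; have := term 1 i; have := term 2%:R i.
rewrite !mxE !mulr1; move: pos.
have [->|->|->] : [\/ label lab tau i s = 0, label lab tau i s = 1 |
    label lab tau i s = 2%:R].
  by case: (label _ _ _ _) => -[|[|[]]]// ?;
    [constructor 1|constructor 2|constructor 3]; exact: val_inj.
all: by move=> *; lra.
Qed.

Definition tropical_cone : set 'rV[R]_(n * 3) := [set x : 'rV[R]_(n * 3) |
  (forall i k, balanced (x 0 (zcoord i k))
                 (x 0 (zcoord i k) + x 0 (zcoord i (k - 1))) 0) /\
  forall j, exp_dot (edge_exponent j) x = 0].

Lemma D_pre_inftyE :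
  D_pre_infty R lab tau e = @unit_sphere R n `&` tropical_cone.
Proof.
have e02 : 0 - 1 = 2%:R :> 'I_3 by exact: val_inj.
have e10 : 1 - 1 = 0 :> 'I_3 by exact: val_inj.
have e21 : 2%:R - 1 = 1 :> 'I_3 by exact: val_inj.
apply/seteqP; split=> x [ux].
  move=> Hx; split=> //; split=> [i k|j].
    have [[[_ /Sph_shape P0] /Sph_shape P1] /Sph_shape P2] := Hx i I.
    apply: (ord3_pred_cases (P := fun k l => balanced (x 0 (zcoord i k))
      (x 0 (zcoord i k) + x 0 (zcoord i l)) 0)); [exact: (P0 isT).2|
      exact: (P1 isT).2|exact: (P2 isT).2].
  have [[[]]] := Hx j I.
  by rewrite poly_gE => /(Sph_binomial _ (edge_exponent_neq0 j))[].
move=> [Hb He]; split=> // i _; split; [split; [split|]|].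
- by rewrite poly_gE; apply/(Sph_binomial _ (edge_exponent_neq0 i)).
- by apply/Sph_shape => //; split=> //; move: (Hb i 0); rewrite e02.
- by apply/Sph_shape => //; split=> //; move: (Hb i 1); rewrite e10.
- by apply/Sph_shape => //; split=> //; move: (Hb i 2%:R); rewrite e21.
Qed.

(** * The logarithmic limit set *)

(** With s = |log|Z||^2, u^2 = 1 / (1 + s) and |w|^2 = s / (1 + s).  Hence u is a
    continuous function of w, vanishing on the unit sphere. *)
Lemma u_factorE (Z : 'rV[R[i]]_(n * 3)) (w := u_factor Z *: log_abs Z) :
  u_factor Z = Num.sqrt (1 - \sum_m w 0 m ^+ 2).
Proof.
rewrite /w /u_factor; set s := \sum_m _.
have s1 : 0 < 1 + s by rewrite ltr_pwDl// sumr_ge0// => m _; rewrite sqr_ge0.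
under eq_bigr do rewrite mxE exprMn.
rewrite -mulr_sumr -/s exprVn sqr_sqrtr ?ltW// -sqrtrV ?ltW//.
by congr Num.sqrt; field; rewrite gt_eqF.
Qed.

Lemma deformation_variety_almost_tropical Z :
  deformation_variety lab tau e Z ->
  let w := u_factor Z *: log_abs Z : 'rV[R]_(n * 3) in
  (forall i k, balanced_upto (Num.sqrt (1 - \sum_m w 0 m ^+ 2) * ln 2)
     (w 0 (zcoord i k)) (w 0 (zcoord i k) + w 0 (zcoord i (k - 1))) 0) /\
  forall j, exp_dot (edge_exponent j) w = 0.
Proof.
move=> [Z0 ZV] w; split=> [i k|j]; last first.
  have [_ _ _] := ZV j; rewrite poly_gE => /(mon_binomial_dot Z0) E.
  by rewrite exp_dotZ E mulr0.
have bal k' l : vanishes (zvar R i k' * (1 - zvar R i l) - 1) Z ->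
    balanced_upto (Num.sqrt (1 - \sum_m w 0 m ^+ 2) * ln 2)
     (w 0 (zcoord i k')) (w 0 (zcoord i k') + w 0 (zcoord i l)) 0.
  rewrite shape_trinomialE -u_factorE => /(mon_trinomial_balanced Z0).
  rewrite exp_dotD !exp_dot_zexp exp_dot0.
  move/(@balanced_scale_upto _ (u_factor Z)).
  by rewrite mulr0 mulrDr !mxE; apply; rewrite invr_ge0 sqrtr_ge0.
have [P0 P1 P2 _] := ZV i.
by apply: (ord3_pred_cases (P := fun k l => balanced_upto _ (w 0 (zcoord i k))
  (w 0 (zcoord i k) + w 0 (zcoord i l)) 0)); exact: bal.
Qed.

Lemma continuous_sqnorm (p : nat) :
  continuous (fun x : 'rV[R]_p => \sum_m x 0 m ^+ 2).
Proof.
move=> x; apply: continuous_sum => m.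
by apply: (continuousM (s := fun y : 'rV[R]_p => y 0 m)); exact: coord_continuous.
Qed.

Lemma continuous_norm2 (p : nat) :
  continuous (fun x : 'rV[R]_p => Num.sqrt (\sum_m x 0 m ^+ 2)).
Proof.
move=> x; apply: continuous_comp; first exact: continuous_sqnorm.
exact: sqrt_continuous.
Qed.

(** A non-strict inequality between continuous functions of w that holds on the
    image of the variety passes to its closure, and the error term vanishes on
    the sphere. *)
Lemma D_infty_sub_pre : D_infty R lab tau e `<=` D_pre_infty R lab tau e.
Proof.
rewrite D_pre_inftyE => x [ux /subset_limit_point clx]; split=> //.
set S := (X in closure X) in clx.
have bound (F : 'rV[R]_(n * 3) -> R) : continuous F ->
    (forall Z, deformation_variety lab tau e Z ->
       0 <= F (u_factor Z *: log_abs Z)) -> 0 <= F x.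
  move=> cF F0; apply: closure_ge0 clx => //.
  by move=> _ [Z DZ <-]; exact: F0.
have cd : continuous
    (fun w : 'rV[R]_(n * 3) => Num.sqrt (1 - \sum_m w 0 m ^+ 2) * ln 2).
  have c1 : continuous (fun w : 'rV[R]_(n * 3) => 1 - \sum_m w 0 m ^+ 2).
    by move=> w; exact: (cvgB (cvg_cst _) (@continuous_sqnorm _ w)).
  move=> w; have c2 := continuous_comp (c1 w) (@sqrt_continuous R _).
  exact: (continuousM c2 (@cst_continuous _ _ (ln 2) w)).
have sqrt0 : Num.sqrt (1 - \sum_m x 0 m ^+ 2) * ln 2 = 0.
  by rewrite ux subrr sqrtr0 mul0r.
have le_bound (F G H : 'rV[R]_(n * 3) -> R) :
    continuous F -> continuous G -> continuous H ->
    (forall Z, deformation_variety lab tau e Z ->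
       let w := u_factor Z *: log_abs Z in
       F w <= Num.max (G w) (H w) + Num.sqrt (1 - \sum_m w 0 m ^+ 2) * ln 2) ->
    F x <= Num.max (G x) (H x) + 0.
  move=> cF cG cH FGH; rewrite -sqrt0 -subr_ge0.
  pose d w : R := Num.max (G w) (H w) + Num.sqrt (1 - \sum_m w 0 m ^+ 2) * ln 2
    - F w.
  apply: (bound d) => [w|Z DZ]; last by rewrite subr_ge0; exact: FGH.
  exact: (cvgB (cvgD (continuous_max (cG w) (cH w)) (cd w)) (cF w)).
split=> [i k|j].
- have c1 := @coord_continuous R 1 (n * 3) 0 (zcoord i k).
  have c2 : continuous (fun w : 'rV[R]_(n * 3) =>
    w 0 (zcoord i k) + w 0 (zcoord i (k - 1))).
    by move=> w; apply: continuousD; exact: coord_continuous.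
  have c3 := @cst_continuous 'rV[R]_(n * 3) R 0.
  have almost Z DZ := (@deformation_variety_almost_tropical Z DZ).1 i k.
  split.
  + by apply: (le_bound _ _ _ c1 c2 c3) => Z /almost[].
  + by apply: (le_bound _ _ _ c2 c1 c3) => Z /almost[].
  + by apply: (le_bound _ _ _ c3 c1 c2) => Z /almost[].
- have cj := @continuous_exp_dot R n (edge_exponent j).
  have tr Z := @deformation_variety_almost_tropical Z.
  apply/eqP; rewrite eq_le -[_ <= 0]oppr_ge0; apply/andP; split.
    apply: (bound (fun w => - exp_dot (edge_exponent j) w)).
      by move=> w; apply: continuousN; exact: cj.
    by move=> Z /tr[_ ->]; rewrite oppr0.
  by apply: bound => // Z /tr[_ ->].
Qed.

Lemma closed_D_infty : closed (D_infty R lab tau e).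
Proof.
apply: closedI.
  have -> : @unit_sphere R n =
      (fun x => \sum_m x 0 m ^+ 2) @^-1` [set 1] by [].
  apply: preimage_closed => [x _|]; first exact: continuous_sqnorm.
  exact: closed_eq.
by apply: limit_point_closed; apply: hausdorff_accessible; exact: norm_hausdorff.
Qed.

(** * Quadrilateral coordinates *)

Definition quad_cone : set 'rV[R]_(n * 3) := [set q : 'rV[R]_(n * 3) |
  [/\ forall m, 0 <= q 0 m,
      forall i (k l : 'I_3),
        q 0 (zcoord i k) != 0 -> q 0 (zcoord i l) != 0 -> k = l
    & forall j, Q_matching lab tau e j q]].

(** On each of the three rays of a tetrahedron exactly one coordinate is
    positive; the quadrilateral type of the ray is the label preceding it. *)
Definition quads x : 'rV[R]_(n * 3) :=
  mxvec (\matrix_(i < n, k < 3) Num.max (x 0 (zcoord i (k + 1))) 0).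

(** The linear map that, on each tetrahedron, takes the three unit vectors to the
    ray generators (0,1,-1), (-1,0,1) and (1,-1,0). *)
Definition shape q : 'rV[R]_(n * 3) :=
  mxvec (\matrix_(i < n, k < 3)
           (q 0 (zcoord i (k - 1)) - q 0 (zcoord i (k + 1)))).

Lemma quadsE x i k :
  quads x 0 (zcoord i k) = Num.max (x 0 (zcoord i (k + 1))) 0.
Proof. by rewrite mxvecE mxE. Qed.

Lemma shapeE q i k :
  shape q 0 (zcoord i k) = q 0 (zcoord i (k - 1)) - q 0 (zcoord i (k + 1)).
Proof. by rewrite mxvecE mxE. Qed.

Lemma ord3_add2 (k : 'I_3) : k + 1 + 1 = k - 1.
Proof. by case: k => -[|[|[]]]// k3; exact: val_inj. Qed.

Lemma eq_by_zcoord x q :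
  (forall i k, x 0 (zcoord i k) = q 0 (zcoord i k)) -> x = q.
Proof.
by move=> E; apply/rowP => m; case/mxvec_indexP: m => i k; exact: E.
Qed.

(** Collecting the terms of the left-hand side by quadrilateral type gives the
    right-hand side of the Q-matching equation with the opposite sign. *)
Lemma edge_shape j q : exp_dot (edge_exponent j) (shape q) = 0 <->
  Q_matching lab tau e j q.
Proof.
have e02 : 0 - 1 = 2%:R :> 'I_3 by exact: val_inj.
have e10 : 1 - 1 = 0 :> 'I_3 by exact: val_inj.
have e21 : 2%:R - 1 = 1 :> 'I_3 by exact: val_inj.
have e11 : 1 + 1 = 2%:R :> 'I_3 by exact: val_inj.
have e20 : 2%:R + 1 = 0 :> 'I_3 by exact: val_inj.
rewrite /Q_matching; set s := \sum_(i < n) _.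
have -> : exp_dot (edge_exponent j) (shape q) = - s.
  rewrite exp_dot_edge -sumrN; apply: eq_bigr => i _.
  by rewrite !shapeE e02 e10 e21 add0r e11 e20; ring.
by split=> [/eqP|<-]; rewrite ?oppr0// oppr_eq0 => /eqP.
Qed.

(** A single balance condition gives each coordinate: by [balanced_posP] it is a
    difference of two positive parts, and those are entries of [quads x]. *)
Lemma shape_quads x : tropical_cone x -> shape (quads x) = x.
Proof.
move=> [bal _]; apply: eq_by_zcoord => i k.
rewrite shapeE !quadsE subrK ord3_add2.
by have [<- _] := balanced_posP (bal i k).
Qed.

Lemma quads_cone x : tropical_cone x -> quad_cone (quads x).
Proof.
move=> tx; have [bal ex] := tx; split=> [m|i k l|j].
- by case/mxvec_indexP: m => i k; rewrite quadsE le_max lexx orbT.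
- rewrite !quadsE => qk ql; apply/eqP/negP => /negP kl.
  have excl (k' : 'I_3) : Num.max (x 0 (zcoord i (k' + 1))) 0 != 0 ->
      Num.max (x 0 (zcoord i k')) 0 != 0 -> False.
    have [_] := balanced_posP (bal i (k' + 1)).
    by rewrite addrK => -[->|->]; rewrite eqxx.
  (* Two distinct elements of a cyclic set of order three are consecutive. *)
  have [kE|lE] : k = l + 1 \/ l = k + 1.
    move: kl; case: k {qk} => -[|[|[]]]// k3; case: l {ql} => -[|[|[]]]// l3 _;
      by [left; exact: val_inj|right; exact: val_inj].
  + by apply: (excl (l + 1)); rewrite // -kE.
  + by apply: (excl (k + 1)); rewrite // -lE.
- by apply/edge_shape; rewrite shape_quads.
Qed.

Lemma quad_excl q i (k l : 'I_3) : quad_cone q -> k != l ->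
  q 0 (zcoord i k) = 0 \/ q 0 (zcoord i l) = 0.
Proof.
move=> [_ adm _] kl.
have [|qk] := eqVneq (q 0 (zcoord i k)) 0; first by left.
have [|ql] := eqVneq (q 0 (zcoord i l)) 0; first by right.
by rewrite (adm i k l) ?eqxx in kl.
Qed.

Lemma ord3_neq (k : 'I_3) : [&& k - 1 != k + 1, k - 1 != k & k + 1 != k].
Proof. by case: k => -[|[|[]]]. Qed.

Lemma shape_cone q : quad_cone q -> tropical_cone (shape q).
Proof.
move=> cq; have [q0 _ match_q] := cq; split=> [i k|j]; last exact/edge_shape.
have /and3P[n1 n2 n3] := ord3_neq k.
rewrite !shapeE subrK -(ord3_add2 (k - 1)) subrK subrKA.
by apply: balanced_diff => //; exact: quad_excl.
Qed.

Lemma quads_shape q : quad_cone q -> quads (shape q) = q.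
Proof.
move=> cq; have [q0 _ _] := cq; apply: eq_by_zcoord => i k.
rewrite quadsE shapeE addrK ord3_add2.
have /and3P[_ n2 _] := ord3_neq k.
have := q0 (zcoord i k); have := q0 (zcoord i (k - 1)).
have := quad_excl i cq n2.
by case=> *; rewrite /Num.max; case: ltP => ?; lra.
Qed.

Lemma quads_homogeneous : homogeneous quads.
Proof.
move=> c x c0; apply: eq_by_zcoord => i k.
by rewrite quadsE !mxE quadsE maxr_pMr ?ltW// mulr0.
Qed.

Lemma shape_homogeneous : homogeneous shape.
Proof.
by move=> c q _; apply: eq_by_zcoord => i k; rewrite shapeE !mxE shapeE mulrBr.
Qed.

Lemma continuous_quads : continuous quads.
Proof.
apply: continuous_row => m; case/mxvec_indexP: m => i k.
under eq_fun do rewrite quadsE.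
by move=> x; apply: continuous_max;
  [exact: coord_continuous|exact: cst_continuous].
Qed.

Lemma continuous_shape : continuous shape.
Proof.
apply: continuous_row => m; case/mxvec_indexP: m => i k.
under eq_fun do rewrite shapeE.
move=> x; exact: (cvgB (@coord_continuous _ _ _ _ _ x)
  (@coord_continuous _ _ _ _ _ x)).
Qed.

Lemma tropical_cone_cone : cone tropical_cone.
Proof.
move=> c x c0 [bal ex]; split=> [i k|j]; last by rewrite exp_dotZ ex mulr0.
by rewrite !mxE -mulrDr -[X in balanced _ _ X](mulr0 c); exact: balanced_scale.
Qed.

(** By transport along the homogeneous bijection [quads]. *)
Lemma quad_cone_cone : cone quad_cone.
Proof.
move=> c q c0 cq; rewrite -(quads_shape cq) -quads_homogeneous//.
by apply: quads_cone; apply: tropical_cone_cone => //; exact: shape_cone.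
Qed.

Lemma homeomorphic_D_pre_PF :
  homeomorphic (D_pre_infty R lab tau e) (PF R lab tau e).
Proof.
pose N1 (x : 'rV[R]_(n * 3)) := Num.sqrt (\sum_m x 0 m ^+ 2).
pose N2 (x : 'rV[R]_(n * 3)) := \sum_m x 0 m.
have -> : D_pre_infty R lab tau e = tropical_cone `&` [set x | N1 x = 1].
  rewrite D_pre_inftyE setIC; congr (_ `&` _).
  apply/seteqP; split=> x; rewrite /= /unit_sphere /N1 /=.
    by move=> ->; rewrite sqrtr1.
  move=> E; rewrite -[LHS]sqr_sqrtr ?E ?expr1n//.
  by apply: sumr_ge0 => m _; exact: sqr_ge0.
have -> : PF R lab tau e = quad_cone `&` [set q | N2 q = 1].
  by apply/seteqP; split=> q; [move=> [? ? ? ?]|move=> [[? ? ?] ?]].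
have shape_neq0 x : N1 x = 1 -> x != 0.
  move=> E; apply/eqP => x0; move: E; rewrite /N1 x0 big1 ?sqrtr0.
    by move/eqP; rewrite eq_sym oner_eq0.
  by move=> m _; rewrite mxE expr0n.
apply: (homeomorphic_of_cones (phi := quads) (psi := shape)).
- exact: tropical_cone_cone.
- exact: quad_cone_cone.
- exact: continuous_norm2.
- by move=> x; apply: continuous_sum => m; exact: coord_continuous.
- move=> c x c0; rewrite /N1; under eq_bigr do rewrite mxE exprMn.
  by rewrite -mulr_sumr sqrtrM ?sqr_ge0// sqrtr_sqr gtr0_norm.
- move=> c x c0; rewrite /N2; under eq_bigr do rewrite mxE.
  by rewrite -mulr_sumr.
- exact: continuous_quads.
- exact: continuous_shape.
- exact: quads_homogeneous.
- exact: shape_homogeneous.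
- exact: quads_cone.
- exact: shape_cone.
- exact: shape_quads.
- exact: quads_shape.
- move=> x tx /shape_neq0; have [q0 _ _] := quads_cone tx.
  rewrite lt_neqAle sumr_ge0 ?andbT//; apply: contra => /eqP/esym s0.
  have qx0 : quads x = 0.
    by apply/rowP => m; rewrite [RHS]mxE; exact: (psumr_eq0P _ s0).
  by rewrite -(shape_quads tx) qx0; apply/eqP/eq_by_zcoord => i k;
    rewrite shapeE !mxE subrr.
- move=> q cq Nq; rewrite sqrtr_gt0 lt_neqAle eq_sym.
  rewrite sumr_ge0 ?andbT => [|m _]; last exact: sqr_ge0.
  apply/eqP => s0.
  have sq0 : shape q = 0.
    apply/rowP => m; rewrite [RHS]mxE; apply/eqP; rewrite -sqrf_eq0; apply/eqP.
    by apply: (psumr_eq0P _ s0) => // k _; exact: sqr_ge0.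
  have q0 : q = 0.
    rewrite -(quads_shape cq) sq0; apply: eq_by_zcoord => i k.
    by rewrite quadsE !mxE maxxx.
  move: Nq; rewrite /N2 q0 big1 => [/eqP|m _]; last by rewrite mxE.
  by rewrite eq_sym oner_eq0.
Qed.

End TropicalCone.

(** * The homeomorphisms *)

Theorem proposition3p1 (R : realType)
    (N : topologicalType)
    (N_manifold : manifold3_with_boundary R N)
    (N_compact : compact [set: N])
    (N_connected : connected [set: N])
    (N_boundary : manifold_boundary R N !=set0)
    (N_tori : boundary_consists_of_tori R N)
    (n : nat) (T : oriented_gluing n)
    (T_triangulates : ideal_triangulation_of R (manifold_interior R N) T)
    (e : 'I_n -> {set 'I_n * {set 'I_4}})
    (e_enum : edge_enumeration T e)
    (lab : {set 'I_4} -> 'I_3)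
    (lab_ok : edge_labelling lab)
    (tau : 'I_n -> {perm 'I_4})
    (tau_oriented : forall i, ~~ odd_perm (tau i)) :
  homeomorphic (D_pre_infty R lab tau e) (PF R lab tau e) /\
  (exists K : set 'rV[R]_(n * 3),
     closed K /\
     homeomorphic (D_infty R lab tau e) (PF R lab tau e `&` K)).
Proof.
have homeo := homeomorphic_D_pre_PF R lab tau e_enum; split=> //.
apply: (homeomorphic_closed_subset homeo); first exact: closed_D_infty.
exact: D_infty_sub_pre e_enum.
Qed.
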